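(* Let $\mathcal{H}_b(V_b,E_b,W_b)$ be a hypergraph with vertex set $V_b=\{1,\dots,n\}$. Let $S=\{\mathcal{H}_i(V_i,E_i):i=1,2,\dots,n\}$ be a collection of regular hypergraphs (not necessarily uniform), let $T=\{T_e:e\in E_b\}$ be a family of sets of admissible new-edge sizes, let $w_m\ge 0$ be constants (one for each size $m$ occurring in some $T_e$), and let $\mathcal{H}=(\mathcal{H}_b,S,T)$. Then for every $p\in\{1,\dots,n\}$ and every non-Perron eigenvalue $\lambda$ of $A_{\mathcal{H}_p}$ with multiplicity $l$, the number $$\lambda-\sum_{e\in E_b,\;p\in e}\;\sum_{m\in T_e}w_m\,d^{S_e(m)}_{pp}$$ is an eigenvalue of $A_{\mathcal{H}}$ with multiplicity at least $l$.
   Context: A (weighted) hypergraph $\mathcal{H}(V,E,W)$ consists of a finite nonempty vertex set $V$, a set $E$ of subsets of $V$ of size at least $2$ (edges), and a weight function $W:E\to\mathbb{R}_{\ge 0}$; $\mathcal{H}(V,E)$ denotes an unweighted hypergraph, i.e. all weights are $1$. The adjacency matrix $A_{\mathcal{H}}$ has zero diagonal and $(A_{\mathcal{H}})_{ij}=\sum_{e\in E;\,i,j\in e}\frac{W(e)}{|e|-1}$ for $i\neq j$. The valency of a vertex $i$ is $\sum_{e\in E,\,i\in e}W(e)$; $\mathcal{H}$ is $r$-regular if all valencies equal $r$, and regular if it is $r$-regular for some $r$. For an $r$-regular hypergraph the Perron eigenvalue is $r$, with the all-ones eigenvector; the non-Perron eigenvalues, with their multiplicities, are those remaining after removing one copy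 of $r$ from the spectrum, i.e. the eigenvalues of $A_{\mathcal{H}}$ restricted to the orthogonal complement of the all-ones vector. Construction of $\mathcal{H}=(\mathcal{H}_b,S,T)$: the vertex sets $V_1,\dots,V_n$ are taken pairwise disjoint, $n_i=|V_i|$, and for each $e\in E_b$, $T_e\subseteq\{|e|,|e|+1,\dots,\sum_{j\in e}n_j\}$. The vertex set of $\mathcal{H}$ is $V=\bigcup_iV_i$. Its edges are all edges of the $\mathcal{H}_i$ (with their own weights) together with, for each $e\in E_b$ and each $m\in T_e$, every $m$-subset $\eta\subseteq\bigcup_{j\in e}V_j$ with $\eta\cap V_j\neq\emptyset$ for all $j\in e$, which is given weight $w_m$. For $e\in E_b$ put $S_e=\{\mathcal{H}_j:j\in e\}$. For $p\in e$ with $n_p\ge 2$ and $m\in T_e$, $d^{S_e(m)}_{pp}$ is $\frac1{m-1}$ times the number of $m$-subsets $\eta\subseteq\bigcup_{j\in e}V_j$ that meet every $V_j$, $j\in e$, and contain two fixed distinct vertices of $V_p$; that is, $$d^{S_e(m)}_{pp}=\frac1{m-1}\sum\binom{n_p-2}{i_p}\prod_{j\in e\setminus\{p\}}\binom{n_j}{i_j},$$ summed over integers $i_p\ge 0$ and $i_j\ge 1$ $(j\in e\setminus\{p\})$ with $\sum_{j\in e}i_j=m-2$. *)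

(* Defs.v *)
From HB Require Import structures.
From mathcomp Require Import all_boot all_order all_algebra.
From mathcomp Require Import finmap reals.

Set Implicit Arguments.
Unset Strict Implicit.
Unset Printing Implicit Defensive.

Import Order.TTheory GRing.Theory Num.Theory.

Local Open Scope ring_scope.

(* Only the values of [weight] on [edges] are meaningful. *)
Record hypergraph (R : realType) (V : finType) := Hypergraph {
  edges : {set {set V}};
  weight : {set V} -> R;
  hg_vertex : (0 < #|V|)%N;
  hg_edge_size : forall e, e \in edges -> (1 < #|e|)%N;
  hg_weight_ge0 : forall e, e \in edges -> 0 <= weight e }.

Definition unweighted (R : realType) (V : finType) (H : hypergraph R V) : Prop :=
  forall e, e \in edges H -> weight H e = 1.

Definition adj_coef (R : realType) (V : finType) (H : hypergraph R V)
    (x y : V) : R :=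
  if x == y then 0
  else \sum_(e in edges H | (x \in e) && (y \in e)) weight H e / (#|e|%:R - 1).

Definition adjmx (R : realType) (V : finType) (H : hypergraph R V) : 'M[R]_#|V| :=
  \matrix_(i, j) adj_coef H (enum_val i) (enum_val j).

Definition valency (R : realType) (V : finType) (H : hypergraph R V) (x : V) : R :=
  \sum_(e in edges H | x \in e) weight H e.

Definition r_regular (R : realType) (V : finType) (H : hypergraph R V) (r : R) : Prop :=
  forall x, valency H x = r.

Definition regular (R : realType) (V : finType) (H : hypergraph R V) : Prop :=
  exists r, r_regular H r.

Definition eigen_mult (R : realType) (k : nat) (A : 'M[R]_k) (a : R) : nat :=
  mup a (char_poly A).

(* [lambda] occurs [l > 0] times in the spectrum of the regular hypergraph [H]
   once a single copy of the Perron eigenvalue [r] has been removed. *)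
Definition nonPerron_eigenvalue (R : realType) (V : finType) (H : hypergraph R V)
    (lambda : R) (l : nat) : Prop :=
  exists r, [/\ r_regular H r, (0 < l)%N
    & (l = eigen_mult (adjmx H) lambda - (lambda == r))%N].

Definition admissible_sizes (R : realType) (n : nat) (Hb : hypergraph R 'I_n)
    (V : 'I_n -> finType) (T : {set 'I_n} -> {fset nat}) : Prop :=
  forall e m, e \in edges Hb -> m \in T e ->
    (#|e| <= m <= \sum_(j in e) #|V j|)%N.

Definition nonneg_weights (R : realType) (n : nat) (Hb : hypergraph R 'I_n)
    (T : {set 'I_n} -> {fset nat}) (w : nat -> R) : Prop :=
  forall e m, e \in edges Hb -> m \in T e -> 0 <= w m.

(* The disjoint union of the [V i] is the sigma type [{i : 'I_n & V i}]. *)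
Definition copy (n : nat) (V : 'I_n -> finType) (i : 'I_n) (f : {set V i}) :
    {set {i : 'I_n & V i}} :=
  [set Tagged V x | x in f].

Definition new_edges (n : nat) (V : 'I_n -> finType) (e : {set 'I_n}) (m : nat) :
    {set {set {i : 'I_n & V i}}} :=
  [set eta : {set {i : 'I_n & V i}} |
    [&& eta \subset \bigcup_(j in e) copy [set: V j], #|eta| == m
      & [forall j in e, eta :&: copy [set: V j] != set0]]].

Lemma bigcup_seq_mem (I : eqType) (U : finType) (s : seq I) (F : I -> {set U}) x :
  x \in \bigcup_(i <- s) F i -> exists2 i, i \in s & x \in F i.
Proof.
elim: s => [|i s IH]; first by rewrite big_nil inE.
rewrite big_cons inE => /orP[xi | /IH[k ks xk]].
  by exists i => //; apply: mem_head.
by exists k => //; rewrite inE ks orbT.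
Qed.

Section Composite.
Variables (R : realType) (n : nat) (Hb : hypergraph R 'I_n).
Variables (V : 'I_n -> finType) (S : forall i, hypergraph R (V i)).
Variables (T : {set 'I_n} -> {fset nat}) (w : nat -> R).

Definition composite_edges : {set {set {i : 'I_n & V i}}} :=
  (\bigcup_(i < n) [set copy f | f in edges (S i)]) :|:
  (\bigcup_(e in edges Hb) \bigcup_(m <- T e) new_edges V e m).

(* Every edge selects exactly one summand of the two double sums: see
   [composite_weight_old] and [composite_weight_new]. *)
Definition composite_weight (eta : {set {i : 'I_n & V i}}) : R :=
  \sum_(i < n) \sum_(f in edges (S i) | copy f == eta) weight (S i) f
  + \sum_(e in edges Hb) \sum_(m <- T e | eta \in new_edges V e m) w m.

Lemma copy_inj i : injective (@copy n V i).
Proof.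
apply: imset_inj => x y /eqP.
by rewrite -tag_eqE /tag_eq eqxx tagged_asE /= => /eqP.
Qed.

Lemma card_copy i (f : {set V i}) : #|copy f| = #|f|.
Proof.
apply: card_imset => x y /eqP.
by rewrite -tag_eqE /tag_eq eqxx tagged_asE /= => /eqP.
Qed.

Lemma mem_copyT j (x : {i : 'I_n & V i}) : (x \in copy [set: V j]) = (tag x == j).
Proof.
apply/imsetP/eqP => [[y _ ->] // | <-].
by exists (tagged x); rewrite ?inE //; case: x.
Qed.

Lemma new_edges_tag e m eta :
  eta \in new_edges V e m -> e = [set tag x | x in eta].
Proof.
rewrite inE => /and3P[/subsetP sub _ /forall_inP meet].
apply/setP => j; apply/idP/imsetP => [/meet/set0Pn[x] | [x xeta ->]].
  by rewrite inE mem_copyT => /andP[xeta /eqP <-]; exists x.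
have /bigcupP[k ke] := sub x xeta.
by rewrite mem_copyT => /eqP ->.
Qed.

Lemma copy_tag i (f : {set V i}) :
  f \in edges (S i) -> [set tag x | x in copy f] = [set i].
Proof.
move=> /hg_edge_size /ltnW /card_gt0P[y yf]; apply/setP => j; rewrite inE.
apply/imsetP/eqP => [[_ /imsetP[x _ ->] ->] // | ->].
by exists (Tagged V y) => //; apply: imset_f.
Qed.

Lemma copy_not_new i (f : {set V i}) e m :
  f \in edges (S i) -> e \in edges Hb -> copy f \notin new_edges V e m.
Proof.
move=> fS /hg_edge_size; apply: contraL => /new_edges_tag ->.
by rewrite copy_tag // cards1.
Qed.

Lemma composite_weight_old i (f : {set V i}) :
  f \in edges (S i) -> composite_weight (copy f) = weight (S i) f.
Proof.
move=> fS; rewrite /composite_weight [X in _ + X]big1 ?addr0; last first.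
  move=> e eb; rewrite big1 // => m.
  by rewrite (negPf (copy_not_new _ fS eb)).
rewrite (bigD1 i) //= [X in _ + X]big1 ?addr0; last first.
  move=> k ki; rewrite big1 // => g /andP[gS /eqP gf].
  have := copy_tag gS; rewrite gf (copy_tag fS) => /set1_inj ik.
  by rewrite ik eqxx in ki.
rewrite (big_pred1 f) // => g /=.
by rewrite (inj_eq (@copy_inj i)) andb_idl // => /eqP ->.
Qed.

Lemma composite_weight_new e m eta :
  e \in edges Hb -> m \in T e -> eta \in new_edges V e m ->
  composite_weight eta = w m.
Proof.
move=> eb mT new; rewrite /composite_weight [X in X + _]big1 ?add0r; last first.
  move=> i _; rewrite big1 // => f /andP[fS /eqP fe].
  by have := copy_not_new m fS eb; rewrite fe new.
rewrite (bigD1 e) //= [X in _ + X]big1 ?addr0; last first.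
  move=> e' /andP[_ ne]; rewrite big1 // => m' /new_edges_tag e'E.
  by rewrite e'E -(new_edges_tag new) eqxx in ne.
rewrite big_mkcond (bigD1_seq m) ?fset_uniq //= new [X in _ + X]big1 ?addr0 //.
move=> m' ne; case: ifP => //; rewrite inE => /and3P[_ /eqP mE _].
by move: new ne; rewrite inE mE => /and3P[_ /eqP -> _]; rewrite eqxx.
Qed.

Hypothesis Tadm : admissible_sizes Hb V T.
Hypothesis w_ge0 : nonneg_weights Hb T w.

Lemma composite_vertex : (0 < #|{: {i : 'I_n & V i}}|)%N.
Proof.
have /card_gt0P[i _] := hg_vertex Hb; have /card_gt0P[x _] := hg_vertex (S i).
by apply/card_gt0P; exists (Tagged V x).
Qed.

Lemma mem_composite_edges eta :
  eta \in composite_edges ->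
  (exists i, exists2 f, f \in edges (S i) & eta = copy f) \/
  (exists e m, [/\ e \in edges Hb, m \in T e & eta \in new_edges V e m]).
Proof.
case/setUP => /bigcupP[i]; first by move=> _ /imsetP[f fS ->]; left; exists i, f.
move=> eb /bigcup_seq_mem[m mT new]; right; by exists i, m.
Qed.

Lemma composite_edge_size eta : eta \in composite_edges -> (1 < #|eta|)%N.
Proof.
case/mem_composite_edges => [[i [f fS ->]] | [e [m [eb mT]]]].
  by rewrite card_copy; apply: hg_edge_size fS.
rewrite inE => /and3P[_ /eqP -> _]; have /andP[em _] := Tadm eb mT.
exact: leq_trans (hg_edge_size eb) em.
Qed.

Lemma composite_weight_ge0 eta :
  eta \in composite_edges -> 0 <= composite_weight eta.
Proof.
case/mem_composite_edges => [[i [f fS ->]] | [e [m [eb mT new]]]].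
  by rewrite composite_weight_old //; apply: hg_weight_ge0.
by rewrite (composite_weight_new eb mT new); apply: w_ge0 eb mT.
Qed.

Definition composite : hypergraph R {i : 'I_n & V i} :=
  Hypergraph composite_vertex composite_edge_size composite_weight_ge0.

End Composite.

(* The summation variable [i] ranges over families with [i j = 0] for [j] outside
   [e]; since all [i j <= m - 2], the type ['I_m] does not restrict the sum. *)
Definition dpp (R : realType) (n : nat) (V : 'I_n -> finType) (e : {set 'I_n})
    (m : nat) (p : 'I_n) : R :=
  (m%:R - 1)^-1 *
  (\sum_(i : {ffun 'I_n -> 'I_m} |
       [&& [forall j in ~: e, i j == 0 :> nat],
           [forall j in e :\ p, 1 <= i j]
         & \sum_(j in e) i j == m - 2])
     'C(#|V p| - 2, i p) * \prod_(j in e :\ p) 'C(#|V j|, i j))%N%:R.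

(* Main.v *)
Require Import Defs.
From HB Require Import structures.
From mathcomp Require Import all_boot all_order all_algebra.
From mathcomp Require Import finmap reals perm.

(** Fix [p] and restrict the adjacency matrix [A] of the composite hypergraph
    to the rows of [V p].  Two distinct vertices of [V p] receive from the new
    edges one and the same extra weight
    [c = \sum_(e | p \in e) \sum_(m <- T e) w m * d_pp], because the number of
    new edges of a given size through both of them is a sum of products of
    binomials that depends only on the sizes of the parts
    ([card_new_edges_pair], [composite_adj_same]).  A vertex outside [V p] is
    coupled with the same weight to all vertices of [V p], because exchanging
    two vertices of [V p] permutes the new edges ([composite_adj_other]).
    Hence, if [E] is the inclusion of the coordinates of [V p] in those of the
    disjoint union and [A_p] is the adjacency matrix of [S p],

      [E A = A_p E - c E + (all-ones column) * beta]

    for some row [beta]: the rank one term collects the constant [c] on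
    [V p] and the constant couplings elsewhere, and [- c E] corrects the zero
    diagonal.

    Let the rows of [Z] be a basis of the hyperplane orthogonal to the all-ones
    vector [1].  Regularity is [A_p 1 = r 1], so the hyperplane is invariant:
    [Z A_p = B Z] for a square matrix [B], whose spectrum is the non-Perron
    spectrum of [S p], since
    [char_poly A_p = char_poly B * ('X - r)] ([perron_deflation]).  The rank one
    term is killed by [Z], so [(Z E) A = (B - c) (Z E)] with [Z E] of full row
    rank, and [char_poly (B - c)] divides [char_poly A]
    ([char_poly_invariant_dvd]).  Comparing orders of vanishing at
    [lambda - c] gives the multiplicity ([multiplicity_of_intertwiner]);
    since [l > 0], this multiplicity also makes [lambda - c] an eigenvalue. *)

Set Implicit Arguments.
Unset Strict Implicit.
Unset Printing Implicit Defensive.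

Import Order.TTheory GRing.Theory Num.Theory.
Local Open Scope ring_scope.

(** * Characteristic polynomials and invariant subspaces *)

(** [P] is allowed two different dimensions, with a proof that they agree: the
    base changes used below are block matrices [col_mx Z W] whose number of
    rows is only provably equal to their number of columns. *)
Lemma char_poly_similar (F : fieldType) m n (P : 'M[F]_(m, n)) (A : 'M_n) (B : 'M_m) :
  m = n -> row_full P -> P *m A = B *m P -> char_poly A = char_poly B.
Proof.
move=> mn; case: n / mn in P A *; rewrite row_full_unit => Pu PA.
have detP0 : \det (map_mx polyC P) != 0.
  by rewrite det_map_mx polyC_eq0 -unitfE -unitmxE.
apply: (mulfI detP0); rewrite /char_poly -det_mulmx [RHS]mulrC -det_mulmx; congr (\det _).
by rewrite /char_poly_mx mulmxBr mulmxBl -!map_mxM PA scalar_mxC.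
Qed.

Lemma char_poly_lblock (F : fieldType) m n (B : 'M[F]_m) (L : 'M_(n, m)) (D : 'M_n) :
  char_poly (block_mx B 0 L D) = char_poly B * char_poly D.
Proof.
rewrite /char_poly /char_poly_mx map_block_mx map_mx0 scalar_mx_block.
by rewrite opp_block_mx add_block_mx oppr0 addr0 det_lblock.
Qed.

(** In the basis formed by the rows of [Z] and [W] the matrix [A] is block
    lower triangular, with [B] and [D] on the diagonal. *)
Lemma char_poly_flag (F : fieldType) m k n (Z : 'M[F]_(m, n)) (W : 'M_(k, n))
    (A : 'M_n) (B : 'M_m) (L : 'M_(k, m)) (D : 'M_k) :
  (m + k = n)%N -> row_full (col_mx Z W) ->
  Z *m A = B *m Z -> W *m A = L *m Z + D *m W ->
  char_poly A = char_poly B * char_poly D.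
Proof.
move=> mkn full ZA WA; rewrite -(char_poly_lblock B L D).
apply: char_poly_similar mkn full _.
by rewrite mul_col_mx mul_block_col mul0mx addr0 ZA WA.
Qed.

(** Completing the rows of [Z] by a complement of their span gives a flag, whose
    other diagonal block is the action of [A] on the quotient. *)
Lemma char_poly_invariant_dvd (F : fieldType) m n (Z : 'M[F]_(m, n)) (A : 'M_n)
    (B : 'M_m) :
  row_free Z -> Z *m A = B *m Z -> char_poly B %| char_poly A.
Proof.
move=> /eqP Zfree ZA; pose W := row_base Z^C%MS.
have full : row_full (col_mx Z W).
  have := addsmx_compl_full Z; rewrite -!sub1mx => /submx_trans; apply.
  by rewrite -addsmxE addsmxS // /W eq_row_base.
have mkn : (m + \rank Z^C%MS = n)%N.
  by rewrite mxrank_compl Zfree subnKC // -[X in (X <= _)%N]Zfree rank_leq_col.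
have /submxP[G WA] : (W *m A <= col_mx Z W)%MS by rewrite submx_full.
rewrite -[G]hsubmxK mul_row_col in WA.
by rewrite (char_poly_flag mkn full ZA WA) dvdp_mulr.
Qed.

Lemma char_poly_shift (F : fieldType) n (A : 'M[F]_n) (c : F) :
  char_poly (A - c%:M) = char_poly A \Po ('X + c%:P).
Proof.
rewrite /char_poly -[RHS]/(comp_poly _ _) -det_map_mx; congr (\det _).
apply/matrixP=> i j; rewrite !mxE /= [RHS]comp_polyB comp_polyC polyCB polyCMn.
by rewrite [comp_poly _ _]raddfMn /= comp_polyX mulrnDl opprB addrA addrAC.
Qed.

Lemma mup_comp_shift (F : fieldType) (q : {poly F}) (a c : F) :
  q \is monic -> (mup a q <= mup (a - c)%R (q \Po ('X + c%:P))%R)%N.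
Proof.
move=> qm; have sh : 'X + c%:P = 'X - (- c)%:P :> {poly F} by rewrite polyCN opprK.
rewrite mup_geq; last by rewrite sh comp_poly2_eq0 ?size_XsubC ?monic_neq0.
have -> : 'X - (a - c)%:P = ('X - a%:P) \Po ('X + c%:P).
  by rewrite comp_polyB comp_polyX comp_polyC polyCB opprB addrA addrAC.
by rewrite -[_ ^+ _]rmorphXn dvdp_comp_poly // -mup_geq ?monic_neq0.
Qed.

(** * Removing the Perron eigenvalue *)

(** [Z] is a basis of the hyperplane orthogonal to the all-ones vector.  The
    quotient by this hyperplane is a line on which [A] acts by [r]: for every
    row [W] the defect [W A - r W] annihilates the all-ones vector, hence lies
    in the hyperplane. *)
Lemma perron_deflation (F : numFieldType) N (A : 'M[F]_N) (r : F) :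
  (0 < N)%N -> A *m const_mx 1 = r *: (const_mx 1 : 'cV_N) ->
  exists k (Z : 'M_(k, N)) (B : 'M_k),
    [/\ row_free Z, Z *m (const_mx 1 : 'cV_N) = 0, Z *m A = B *m Z
      & char_poly A = char_poly B * ('X - r%:P)].
Proof.
move=> N_gt0 A1; pose one : 'cV[F]_N := const_mx 1.
pose K := kermx one; pose Z := row_base K.
(* The factor [1 / N] makes [one *m W] a projection along the hyperplane. *)
pose W : 'rV[F]_N := const_mx N%:R^-1.
have N0 : N%:R != 0 :> F by rewrite pnatr_eq0 -lt0n.
have W1 : W *m one = 1%:M.
  apply/matrixP=> i j; rewrite !ord1 !mxE.
  under eq_bigr do rewrite !mxE mulr1.
  by rewrite sumr_const card_ord -[LHS]mulr_natl mulfV.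
have subZ k (M : 'M_(k, N)) : (M <= Z)%MS = (M *m one == 0).
  by rewrite /Z eq_row_base /K sub_kermx.
have Z1 : Z *m one = 0 by apply/eqP; rewrite -subZ.
have rk1 : \rank one = 1%N.
  apply/eqP; rewrite eqn_leq rank_leq_col lt0n mxrank_eq0.
  apply/eqP => /matrixP/(_ (Ordinal N_gt0) 0)/eqP.
  by rewrite !mxE oner_eq0.
have ZA : (Z *m A <= Z)%MS by rewrite subZ -mulmxA A1 -scalemxAr Z1 scaler0.
have WA : (W *m A - r%:M *m W <= Z)%MS.
  by rewrite subZ mulmxBl -!mulmxA A1 -scalemxAr W1 mul_scalar_mx subrr.
case/submxP: ZA => B ZA; case/submxP: WA => L WA.
have full : row_full (col_mx Z W).
  rewrite -sub1mx -(subrK (one *m W) 1%:M) addmx_sub //.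
    have /submx_trans-> // : (1%:M - one *m W <= Z)%MS.
      by rewrite subZ mulmxBl -mulmxA W1 mulmx1 mul1mx subrr.
    by rewrite -addsmxE addsmxSl.
  by rewrite -addsmxE (submx_trans (submxMl _ _)) // addsmxSr.
exists _, Z, B; split=> //; first exact: row_base_free.
have -> : 'X - r%:P = char_poly (r%:M : 'M[F]_1).
  by rewrite char_poly_trig ?scalar_mx_is_trig // big_ord1 mxE.
apply: (char_poly_flag (L := L) _ full) => //.
  by rewrite mxrank_ker rk1 subnK.
by rewrite -WA subrK.
Qed.

(** Restricting [E] to vectors orthogonal to the all-ones vector kills the rank
    one term, so that it intertwines [A - c] with [A'] there; the subtracted
    [(a == r)] is the copy of [r] lost in this restriction. *)
Lemma multiplicity_of_intertwiner (F : numFieldType) N N' (A : 'M[F]_N) (A' : 'M[F]_N')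
    (E : 'M_(N, N')) (beta : 'rV_N') (c r a : F) :
  (0 < N)%N -> A *m const_mx 1 = r *: (const_mx 1 : 'cV_N) -> row_free E ->
  E *m A' = A *m E - c *: E + const_mx 1 *m beta ->
  (mup a (char_poly A) - (a == r) <= mup (a - c)%R (char_poly A'))%N.
Proof.
move=> N_gt0 /(perron_deflation N_gt0)[k [Z [B [Zfree Z1 ZA ->]]]] Efree EA.
have Bm := char_poly_monic B; have A'm := char_poly_monic A'.
rewrite mupM ?monic_neq0 ?monicXsubC //.
rewrite -['X - r%:P]expr1 mup_XsubCX [a == r]eq_sym.
rewrite (_ : (if _ then _ else _) = (r == a)%N :> nat); last by case: (r == a).
rewrite addnK; apply: leq_trans (mup_comp_shift a c Bm) _.
rewrite -char_poly_shift mup_geq ?monic_neq0 //.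
apply: (@dvdp_trans _ (char_poly (B - c%:M))).
  by rewrite -mup_geq //; apply/monic_neq0/char_poly_monic.
apply: (@char_poly_invariant_dvd _ _ _ (Z *m E)).
  by rewrite /row_free mxrankMfree.
rewrite -mulmxA EA mulmxDr mulmxBr !mulmxA Z1 mul0mx addr0 ZA.
by rewrite -scalemxAr !mulmxBl mul_scalar_mx -scalemxAl.
Qed.

(** * Counting the new edges through two vertices *)

(** A set is determined by its traces on the fibers of [t], and these can be
    chosen independently of one another. *)
Lemma card_sets_profile (T I : finType) (t : T -> I) (U : {set T}) (k : I -> nat) :
  #|[set D : {set T} | (D \subset U) &&
       [forall j, #|D :&: t @^-1: [set j]| == k j]]|
  = (\prod_j 'C(#|U :&: t @^-1: [set j]|, k j))%N.
Proof.
pose traces (D : {set T}) := [ffun j => D :&: t @^-1: [set j]].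
have traces_inj : injective traces.
  move=> D D' /ffunP eqDD'; apply/setP=> x.
  by have /setP/(_ x) := eqDD' (t x); rewrite !ffunE !inE eqxx !andbT.
pose draws j := [set A : {set T} | A \subset U :&: t @^-1: [set j] & #|A| == k j].
transitivity (\prod_j #|draws j|)%N; last by apply: eq_bigr => j _; apply: cards_draws.
rewrite -(card_imset _ traces_inj).
transitivity #|(family draws : simpl_pred {ffun I -> {set T}})|; last first.
  by rewrite card_family foldrE big_map big_enum.
apply: eq_card => G; apply/imsetP/familyP => [[D] | GP].
  rewrite inE => /andP[DU /forallP Dk] -> j.
  by rewrite ffunE inE setSI //= Dk.
have GE j x : x \in G j -> (x \in U) /\ t x = j.
  have := GP j; rewrite inE subsetI => /andP[/andP[/subsetP GU /subsetP Gt] _] xG.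
  by split; [apply: GU | have := Gt x xG; rewrite !inE => /eqP].
have traceE j : (\bigcup_i G i) :&: t @^-1: [set j] = G j.
  apply/setP=> x; rewrite !inE; apply/andP/idP.
    by case=> /bigcupP[i _ xGi] /eqP <-; have [_ ->] := GE _ _ xGi.
  by move=> xG; rewrite (GE _ _ xG).2; split=> //; apply/bigcupP; exists j.
exists (\bigcup_j G j); last by apply/ffunP=> j; rewrite ffunE traceE.
rewrite inE; apply/andP; split.
  by apply/bigcupsP=> j _; apply/subsetP=> x /GE[].
by apply/forallP=> j; rewrite traceE; have := GP j; rewrite inE => /andP[].
Qed.

Lemma sum_card_fibers (T I : finType) (t : T -> I) (D : {set T}) :
  (\sum_j #|D :&: t @^-1: [set j]| = #|D|)%N.
Proof.
rewrite -sum1_card (partition_big t xpredT) //=; apply: eq_bigr => j _.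
by rewrite -sum1_card; apply: eq_bigl => x; rewrite !inE.
Qed.

(** The two conditions of being contained in the parts indexed by [e] and of
    meeting each of them merge into one about the image under [tag], which is
    visibly invariant under permutations that preserve tags. *)
Lemma in_new_edges (n : nat) (V : 'I_n -> finType) (e : {set 'I_n}) m
    (eta : {set {i : 'I_n & V i}}) :
  (eta \in new_edges V e m) = (#|eta| == m) && ([set tag x | x in eta] == e).
Proof.
apply/idP/andP => [new | [size_eta /eqP <-]].
  by rewrite -(new_edges_tag new) eqxx; move: new; rewrite inE => /and3P[].
rewrite inE size_eta /=; apply/andP; split.
  apply/subsetP=> x xeta; apply/bigcupP; exists (tag x); first exact: imset_f.
  by rewrite mem_copyT.
apply/forall_inP=> _ /imsetP[x xeta ->]; apply/set0Pn; exists x.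
by rewrite inE xeta mem_copyT /=.
Qed.

Definition new_edges_through (n : nat) (V : 'I_n -> finType) (e : {set 'I_n}) m
    (x y : {i : 'I_n & V i}) :=
  [set eta in new_edges V e m | (x \in eta) && (y \in eta)].

Lemma in_new_edges_through (n : nat) (V : 'I_n -> finType) (e : {set 'I_n}) m
    (x y : {i : 'I_n & V i}) eta :
  (eta \in new_edges_through e m x y) =
  [&& #|eta| == m, [set tag z | z in eta] == e, x \in eta & y \in eta].
Proof. by rewrite [LHS]in_set in_new_edges -andbA. Qed.

(** Exchanging [x] and [x'] is a bijection, as it preserves tags and fixes
    [y]. *)
Lemma card_new_edges_tperm (n : nat) (V : 'I_n -> finType) (e : {set 'I_n}) m
    (x x' y : {i : 'I_n & V i}) :
  tag x = tag x' -> tag y != tag x ->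
  #|new_edges_through e m x y| = #|new_edges_through e m x' y|.
Proof.
move=> xx' yx; pose s := tperm x x'.
have s_tag z : tag (s z) = tag z by rewrite /s; case: tpermP => // ->.
have s_inj : injective (fun eta : {set _} => s @: eta) := imset_inj (@perm_inj _ s).
have le a b : s a = b -> s y = y ->
    (#|new_edges_through e m a y| <= #|new_edges_through e m b y|)%N.
  move=> sab sy; rewrite -(card_imset _ s_inj) subset_leq_card //.
  apply/subsetP=> _ /imsetP[eta + ->].
  rewrite !in_new_edges_through card_imset; last exact: perm_inj.
  rewrite -imset_comp (eq_imset (g := tag)) // => /and4P[-> -> aeta yeta] /=.
  by rewrite -sab -{1}sy !imset_f.
have sy : s y = y.
  by rewrite tpermD //; apply: contraNneq yx => <-; rewrite ?xx'.
by apply/eqP; rewrite eqn_leq !le // /s (tpermL, tpermR).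
Qed.

Lemma mem_imset_fiber (T I : finType) (t : T -> I) (D : {set T}) j :
  (j \in [set t x | x in D]) = (0 < #|D :&: t @^-1: [set j]|)%N.
Proof.
apply/imsetP/card_gt0P => [[x xD ->] | [x]].
  by exists x; rewrite !inE xD /=.
by rewrite !inE => /andP[xD /eqP <-]; exists x.
Qed.

Lemma card_fiber_tag (n : nat) (V : 'I_n -> finType) (j : 'I_n) :
  #|[set z : {i : 'I_n & V i} | tag z == j]| = #|V j|.
Proof.
rewrite -cardsT -card_copy; apply: eq_card => z.
by rewrite mem_copyT inE.
Qed.

(** Removing [x] and [y] from a new edge leaves an [(m - 2)]-subset of the
    remaining vertices that need no longer meet the part [p].  These subsets
    are classified by the sizes of their traces on the parts. *)
Lemma card_new_edges_pair (n : nat) (V : 'I_n -> finType) (e : {set 'I_n}) m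
    (p : 'I_n) (x y : {i : 'I_n & V i}) :
  x != y -> tag x = p -> tag y = p -> p \in e -> (1 < m)%N ->
  #|new_edges_through e m x y| =
  (\sum_(i : {ffun 'I_n -> 'I_m} |
       [&& [forall j in ~: e, i j == 0 :> nat],
           [forall j in e :\ p, 1 <= i j]
         & \sum_(j in e) i j == m - 2])
     'C(#|V p| - 2, i p) * \prod_(j in e :\ p) 'C(#|V j|, i j))%N.
Proof.
move=> xy xp yp pe; case: m => [|[|m]] // _.
pose fib j := @tag _ V @^-1: [set j].
pose U := ~: [set x; y].
(* The new edges with [x] and [y] removed. *)
pose rests := [set D : {set {i : 'I_n & V i}} |
  [&& D \subset U, #|D| == m & p |: [set tag z | z in D] == e]].
have sub_U (D : {set {i : 'I_n & V i}}) : (D \subset U) = (x \notin D) && (y \notin D).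
  by rewrite /U -setCS setCK subUset !sub1set !inE.
have -> : #|new_edges_through e m.+2 x y| = #|rests|.
  have add_inj : {in rests &, injective (fun D => x |: (y |: D))}.
    move=> D D'; rewrite !inE !sub_U => /and3P[/andP[xD yD] _ _].
    move=> /and3P[/andP[xD' yD'] _ _] /(congr1 (fun E => E :\ x)).
    rewrite !setU1K ?inE ?negb_or ?xy // => /(congr1 (fun E => E :\ y)).
    by rewrite !setU1K.
  rewrite -(card_in_imset add_inj); apply: eq_card => eta.
  have addE (D : {set {i : 'I_n & V i}}) : x \notin D -> y \notin D ->
      (x |: (y |: D) \in new_edges_through e m.+2 x y) = (D \in rests).
    move=> xD yD; rewrite in_new_edges_through !inE sub_U xD yD.
    rewrite !cardsU1 !inE negb_or xy xD yD !eqxx orbT !andbT !add1n.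
    by rewrite !imsetU1 xp yp setUA setUid.
  apply/idP/imsetP => [thr | [D Dr ->]]; last first.
    by rewrite addE //; move: Dr; rewrite inE sub_U => /and3P[/andP[]].
  have := thr; rewrite in_new_edges_through => /and4P[_ _ xeta yeta].
  have etaE : eta = x |: (y |: (eta :\ x :\ y)).
    by rewrite !setD1K // !inE eq_sym xy.
  exists (eta :\ x :\ y) => //.
  by rewrite -addE -?etaE // !inE eqxx ?andbF.
(* [inord] never truncates here: a trace has at most [#|D| = m < m.+2]
   elements. *)
pose prof (D : {set {i : 'I_n & V i}}) : {ffun 'I_n -> 'I_m.+2} :=
  [ffun j => inord #|D :&: fib j|].
pose Q (i : {ffun 'I_n -> 'I_m.+2}) := [&& [forall j in ~: e, i j == 0 :> nat],
           [forall j in e :\ p, 1 <= i j]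
         & \sum_(j in e) i j == m.+2 - 2]%N.
have prof_val D j : D \in rests -> prof D j = #|D :&: fib j| :> nat.
  rewrite inE => /and3P[_ /eqP sD _]; rewrite ffunE inordK //.
  by rewrite ltnS -sD; apply/leqW/subset_leq_card/subsetIl.
have sum_out (k : 'I_n -> nat) : (forall j, j \notin e -> k j = 0%N) ->
    (\sum_j k j = \sum_(j in e) k j)%N.
  by move=> k0; rewrite (bigID (mem e)) /= [X in (_ + X)%N]big1 ?addn0.
have memD D j : D \in rests -> j != p -> (j \in e) = (0 < #|D :&: fib j|)%N.
  rewrite inE => /and3P[_ _ /eqP <-] jp.
  by rewrite !inE (negPf jp) mem_imset_fiber.
have profQ D : D \in rests -> Q (prof D).
  move=> Dr.
  have out j : j \notin e -> #|D :&: fib j| = 0%N.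
    move=> je; have jp : j != p by apply: contraNneq je => ->.
    by apply/eqP; rewrite -leqn0 leqNgt -(memD D).
  apply/and3P; split.
  - by apply/forall_inP=> j; rewrite inE prof_val // => /out ->.
  - by apply/forall_inP=> j /setD1P[jp je]; rewrite prof_val // -memD.
  under eq_bigr do rewrite prof_val //.
  rewrite -sum_out // sum_card_fibers subn2 /=.
  by move: Dr; rewrite inE => /and3P[].
rewrite -sum1_card (partition_big prof Q profQ); apply: eq_bigr => i Qi.
have /and3P[/forall_inP i0 /forall_inP i1 /eqP isum] := Qi.
transitivity (\prod_j 'C(#|U :&: fib j|, i j))%N; last first.
  have Ufib j : #|U :&: fib j| = (#|V j| - (j == p).*2)%N.
    rewrite /U setIC -setDE; have cardV : #|fib j| = #|V j|.
      by rewrite -card_fiber_tag; apply: eq_card => z; rewrite !inE.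
    case: eqVneq => jp; rewrite ?subn0 -cardV.
      by rewrite cardsDS ?cards2 ?xy // subUset !sub1set !inE xp yp jp eqxx.
    suff /setDidPl-> : [disjoint fib j & [set x; y]] by [].
    by rewrite disjoint_sym disjoints_subset subUset !sub1set !inE xp yp eq_sym jp.
  rewrite (bigID (mem e)) /= [X in (_ * X)%N]big1 ?muln1; last first.
    by move=> j je; rewrite (eqP (i0 j _)) ?bin0 // inE.
  rewrite (bigD1 p) //= Ufib eqxx; congr (_ * _)%N.
  apply: eq_big => [j | j /andP[_ jp]]; first by rewrite !inE andbC.
  by rewrite Ufib (negPf jp) subn0.
rewrite -card_sets_profile sum1_card; apply: eq_card => D.
rewrite inE unfold_in; apply/andP/andP => [[Dr /eqP profD] | [DU /forallP Di]].
  split; first by move: Dr; rewrite inE => /and3P[].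
  by apply/forallP=> j; rewrite -prof_val // profD.
have Dr : D \in rests.
  rewrite inE DU /=; apply/andP; split.
    rewrite -(sum_card_fibers (@tag _ V)); under eq_bigr do rewrite (eqP (Di _)).
    rewrite sum_out ?isum ?subn2 // => j je.
    by apply/eqP/i0; rewrite inE.
  apply/eqP/setP=> j; rewrite !inE mem_imset_fiber (eqP (Di j)).
  case: eqVneq => [-> // | jp] /=.
  case: (boolP (j \in e)) => je; first by apply: i1; rewrite !inE jp.
  by rewrite (eqP (i0 j _)) // inE.
split=> //; apply/eqP/ffunP=> j; apply: val_inj.
by rewrite /= prof_val // (eqP (Di j)).
Qed.

(** An edge [e] through [x] contributes [weight e / (#|e| - 1)] once for each of
    its [#|e| - 1] other vertices. *)
Lemma adj_row_sum (R : realType) (V : finType) (H : hypergraph R V) x :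
  \sum_y adj_coef H x y = valency H x.
Proof.
transitivity (\sum_(y | x != y)
    \sum_(e in edges H | (x \in e) && (y \in e)) weight H e / (#|e|%:R - 1)).
  by rewrite [RHS]big_mkcond; apply: eq_bigr => y _; rewrite /adj_coef; case: eqP.
rewrite (exchange_big_dep (fun e => (e \in edges H) && (x \in e))) /=; last first.
  by move=> y e _ /and3P[-> ->].
apply: eq_bigr => e /andP[eH xe].
rewrite (eq_bigl (mem (e :\ x))); last first.
  by move=> y; rewrite !inE eH xe eq_sym.
have cardE : #|e| = #|e :\ x|.+1 by rewrite (cardsD1 x) xe.
have := hg_edge_size eH; rewrite sumr_const cardE -natr1 addrK ltnS => gt0.
by rewrite -[LHS]mulr_natr divfK // pnatr_eq0 -lt0n.
Qed.

(** * The adjacency matrix of the composite hypergraph *)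

Section CompositeAdjacency.
Variables (R : realType) (n : nat) (Hb : hypergraph R 'I_n).
Variables (V : 'I_n -> finType) (S : forall i, hypergraph R (V i)).
Variables (T : {set 'I_n} -> {fset nat}) (w : nat -> R).
Hypothesis (T_adm : admissible_sizes Hb V T).
Hypothesis (w_ge0 : nonneg_weights Hb T w).

(** The weight of an edge is itself a sum over the ways in which the edge
    arises, so this is an exchange of summations. *)
Lemma composite_edge_sum (F : {set {i : 'I_n & V i}} -> R) :
  \sum_(eta in composite_edges Hb S T) composite_weight Hb S T w eta * F eta =
    \sum_(i < n) \sum_(f in edges (S i)) weight (S i) f * F (copy f)
  + \sum_(e in edges Hb) \sum_(m <- T e)
      w m * \sum_(eta in new_edges V e m) F eta.
Proof.
under eq_bigr do rewrite mulrDl !big_distrl /=.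
rewrite big_split /=; congr (_ + _).
  rewrite exchange_big /=; apply: eq_bigr => i _.
  under eq_bigr do rewrite big_distrl /=.
  rewrite (exchange_big_dep (mem (edges (S i)))) /=; last by move=> eta f _ /andP[].
  apply: eq_bigr => f fS; rewrite (big_pred1 (copy f)) // => eta /=.
  rewrite fS /= [LHS]andbC eq_sym andb_idr // => /eqP ->.
  by apply/setUP; left; apply/bigcupP; exists i => //; apply: imset_f.
rewrite exchange_big /=; apply: eq_bigr => e eb.
under eq_bigr do rewrite big_distrl /= big_mkcond /=.
rewrite exchange_big big_seq [RHS]big_seq /=; apply: eq_bigr => m mT.
rewrite -big_mkcondr big_distrr /=; apply: eq_bigl => eta.
apply: andb_idl => new; apply/setUP; right; apply/bigcupP; exists e => //.
by rewrite (big_rem m) //= inE new.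
Qed.

Lemma composite_adj (x y : {i : 'I_n & V i}) : x != y ->
  adj_coef (composite S T_adm w_ge0) x y =
    \sum_(i < n) \sum_(f in edges (S i) | (x \in copy f) && (y \in copy f))
       weight (S i) f / (#|f|%:R - 1)
  + \sum_(e in edges Hb) \sum_(m <- T e)
      w m * ((m%:R - 1)^-1 * #|new_edges_through e m x y|%:R).
Proof.
move=> xy; rewrite /adj_coef (negPf xy).
rewrite big_mkcondr /=.
pose F (eta : {set {i : 'I_n & V i}}) : R :=
  if (x \in eta) && (y \in eta) then (#|eta|%:R - 1)^-1 else 0.
transitivity (\sum_(eta in composite_edges Hb S T) composite_weight Hb S T w eta * F eta).
  by apply: eq_bigr => eta _; rewrite /F; case: ifP; rewrite ?mulr0.
rewrite composite_edge_sum; congr (_ + _).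
  apply: eq_bigr => i _; rewrite big_mkcondr; apply: eq_bigr => f _.
  by rewrite /F card_copy; case: ifP; rewrite ?mulr0.
apply: eq_bigr => e _; apply: eq_bigr => m _; congr (_ * _).
rewrite /F -big_mkcondr /= mulr_natr -sumr_const.
apply: eq_big => eta; first by rewrite [RHS]in_set.
by rewrite in_new_edges => /andP[/andP[/eqP -> _] _].
Qed.

(** The constant [c] by which the new edges raise each off-diagonal entry
    between vertices of [V p]. *)
Definition coupling (p : 'I_n) : R :=
  \sum_(e in edges Hb | p \in e) \sum_(m <- T e) w m * dpp R V e m p.

Lemma mem_copy_Tagged i (f : {set V i}) (x : V i) :
  (Tagged V x \in copy f) = (x \in f).
Proof.
apply/imsetP/idP => [[y yf /eqP]|xf]; last by exists x.
by rewrite -tag_eqE /tag_eq eqxx tagged_asE /= => /eqP ->.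
Qed.

Lemma composite_adj_same p (x y : V p) : x != y ->
  adj_coef (composite S T_adm w_ge0) (Tagged V x) (Tagged V y) =
  adj_coef (S p) x y + coupling p.
Proof.
move=> xy; have xy' : Tagged V x != Tagged V y.
  by rewrite -tag_eqE /tag_eq eqxx tagged_asE.
rewrite composite_adj //; congr (_ + _).
  rewrite (bigD1 p) //= [X in _ + X]big1 ?addr0.
    rewrite /adj_coef (negPf xy); apply: eq_bigl => f.
    by rewrite !mem_copy_Tagged.
  move=> i ip; rewrite big1 // => f /andP[_ /andP[/imsetP[z _ /(congr1 tag) /= pi]]].
  by rewrite pi eqxx in ip.
rewrite /coupling big_mkcondr; apply: eq_bigr => e eb.
case: ifP => pe; last first.
  rewrite big1 // => m _; rewrite (_ : #|_| = 0%N) ?mulr0 //.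
  apply: eq_card0 => eta; rewrite in_new_edges_through; apply/negP.
  case/and4P=> _ /eqP tags xeta _.
  by move: pe; rewrite -tags => /imsetP; apply; exists (Tagged V x).
rewrite big_seq [RHS]big_seq; apply: eq_bigr => m mT; congr (_ * _).
rewrite /dpp -(@card_new_edges_pair _ _ _ _ _ (Tagged V x) (Tagged V y)) //.
have /andP[em _] := T_adm eb mT.
exact: leq_trans (hg_edge_size eb) em.
Qed.

Lemma composite_adj_other p (x x' : V p) (z : {i : 'I_n & V i}) : tag z != p ->
  adj_coef (composite S T_adm w_ge0) (Tagged V x) z =
  adj_coef (composite S T_adm w_ge0) (Tagged V x') z.
Proof.
move=> zp; have ne u : Tagged V (u : V p) != z.
  by apply: contraNneq zp => <-.
have old u : \sum_(i < n) \sum_(f in edges (S i) | (Tagged V (u : V p) \in copy f)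
     && (z \in copy f)) weight (S i) f / (#|f|%:R - 1) = 0.
  rewrite big1 // => i _; rewrite big1 // => f /andP[_ /andP[]].
  case/imsetP=> a _ /(congr1 tag) /= pi /imsetP[b _ /(congr1 tag) /= zi].
  by rewrite pi zi eqxx in zp.
rewrite !composite_adj // !old; congr (_ + _).
apply: eq_bigr => e _; apply: eq_bigr => m _.
by rewrite (@card_new_edges_tperm _ _ _ _ _ (Tagged V x')).
Qed.

End CompositeAdjacency.

Theorem theorem3p2p1 (R : realType) (n : nat) (Hb : hypergraph R 'I_n)
    (V : 'I_n -> finType) (S : forall i : 'I_n, hypergraph R (V i))
    (T : {set 'I_n} -> {fset nat}) (w : nat -> R)
    (S_unweighted : forall i : 'I_n, unweighted (S i))
    (S_regular : forall i : 'I_n, regular (S i))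
    (T_adm : admissible_sizes Hb V T)
    (w_ge0 : nonneg_weights Hb T w)
    (p : 'I_n) (lambda : R) (l : nat)
    (lambda_eig : nonPerron_eigenvalue (S p) lambda l) :
  let mu := lambda - \sum_(e in edges Hb | p \in e) \sum_(m <- T e)
                        w m * dpp R V e m p in
  let A := adjmx (composite S T_adm w_ge0) in
  eigenvalue A mu /\ (l <= eigen_mult A mu)%N.
Proof.
move=> mu A; case: lambda_eig => r [reg l_gt0 lE].
have Vp_gt0 := hg_vertex (S p); have /card_gt0P[x0 _] := Vp_gt0.
have le_l : (l <= eigen_mult A mu)%N.
  pose iota (i : 'I_#|V p|) := enum_rank (Tagged V (enum_val i)).
  have iota_inj : injective iota.
    move=> i k /enum_rank_inj/eqP.
    by rewrite -tag_eqE /tag_eq eqxx tagged_asE /= => /eqP/enum_val_inj.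
  pose E : 'M[R]_(#|V p|, #|{: {i : 'I_n & V i}}|) := rowsub iota 1%:M.
  (* By [composite_adj_other] any vertex of [V p] could replace [x0]. *)
  pose beta : 'rV[R]_#|{: {i : 'I_n & V i}}| :=
    \row_j (if tag (enum_val j) == p then coupling Hb V T w p
            else adj_coef (composite S T_adm w_ge0) (Tagged V x0) (enum_val j)).
  rewrite lE /eigen_mult.
  apply: (@multiplicity_of_intertwiner _ _ _ _ _ E beta) => //.
  (* The row sums of the adjacency matrix are the valencies. *)
  - apply/matrixP=> i j; rewrite !mxE mulr1 -(reg (enum_val i)) -adj_row_sum.
    rewrite (reindex (@enum_val (V p) predT)) /=; last first.
      by exists enum_rank => z _; rewrite (enum_valK, enum_rankK).
    by apply: eq_bigr => k _; rewrite !mxE mulr1.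
  - apply/row_freeP; exists E^T; rewrite mul_rowsub_mx mul1mx.
    by apply/matrixP=> i j; rewrite !mxE eq_sym (inj_eq iota_inj).
  rewrite mul_rowsub_mx mul1mx; apply/matrixP=> i j.
  rewrite !mxE big_ord1 !mxE mul1r enum_rankK.
  under eq_bigr do rewrite !mxE.
  case: (eqVneq (tag (enum_val j)) p) => jp.
    have [k ->] : exists k, j = iota k.
      have [y jy] : exists y : V p, enum_val j = Tagged V y.
        by move: jp; case: (enum_val j) => q y /= qp; move: y; rewrite qp => y; exists y.
      by exists (enum_rank y); rewrite /iota enum_rankK -jy enum_valK.
    rewrite (bigD1 k) //= big1 ?addr0; last first.
      by move=> k' ne; rewrite (inj_eq iota_inj) (negPf ne) mulr0.
    rewrite eqxx mulr1 (inj_eq iota_inj) enum_rankK.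
    (* On the diagonal, [- c] from [- c *: E] cancels [c] from [beta]. *)
    case: eqVneq => [-> | ik]; first by rewrite /adj_coef !eqxx mulr1 add0r addNr.
    by rewrite mulr0 subr0 composite_adj_same // (inj_eq enum_val_inj).
  have ne k : (iota k == j) = false.
    by apply: contra_neqF jp => /eqP <-; rewrite enum_rankK.
  rewrite ne mulr0 subr0 big1 => [|k _]; last by rewrite ne mulr0.
  by rewrite add0r; apply: composite_adj_other.
split=> //; rewrite eigenvalue_root_char.
have := leq_trans l_gt0 le_l; rewrite -XsubC_dvd ?dvdp_XsubCl //.
exact/monic_neq0/char_poly_monic.
Qed.
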